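(* Let $G$ be a graph, and let $\sigma$ be a cyclic order of $V(G)$. Suppose there is a subset $V' \subseteq V(G)$ such that (i) every non-edge of $G$ is incident to a vertex in $V'$, and (ii) every vertex in $V'$ has the consecutive-neighbors property with respect to $\sigma$. Then $G$ admits a convex outside-obstacle representation (OOR) with cyclic vertex order $\sigma$ on any set of points in convex position; that is, for every set $P$ of $|V(G)|$ points in convex position in the plane, every bijection $V(G)\to P$ for which the clockwise cyclic order of the vertices along the convex hull of $P$ is $\sigma$ yields an OOR of $G$.
   Context: All graphs are finite and simple. A vertex $v$ of $G$ has the consecutive-neighbors property with respect to a cyclic order $\sigma$ of $V(G)$ if all neighbors of $v$ are consecutive in $\sigma$, i.e., the set of neighbors of $v$ is empty or is exactly the set of vertices of a contiguous interval of the cyclic order $\sigma$ (such an interval does not contain $v$ itself, since $v$ is not its own neighbor). A straight-line drawing $\Gamma$ of a graph $G$ maps the vertices to pairwise distinct points of $\mathbb{R}^2$ and each edge to the closed line segment between its endpoints. The outer face of $\Gamma$ is the unbounded connected component of the complement in $\mathbb{R}^2$ of the union of all vertex points and edge segments. A non-edge of $G$ is a pair of distinct non-adjacent vertices; it is identified with the line segment between its endpoints. An outside-obstacle representation (OOR) of $G$ is a straight-line drawing of $G$ such that no edge segment contains a vertex point other than its two endpoints and every non-edge segment intersects the outer face of the drawing. (Equivalently, $G$ is the visibility graph of the point set with respect to a single obstacle, namely the open outer face of the drawing.) An OOR is convex if the vertex points are in convex position, i.e., each vertex point is a corner of the convex hull of all vertex points. *)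

(* Defs.v *)
From HB Require Import structures.
From mathcomp Require Import all_boot all_order all_algebra.
From mathcomp Require Import boolp classical_sets functions.
From mathcomp Require Import reals topology normedtype convex.

Set Implicit Arguments.
Unset Strict Implicit.
Unset Printing Implicit Defensive.

Import Order.TTheory GRing.Theory Num.Theory.
Import numFieldNormedType.Exports.

Local Open Scope classical_set_scope.
Local Open Scope ring_scope.

Section Graphs.
Variables (T : finType) (e : rel T).

Definition nonedge (v w : T) : bool := (v != w) && ~~ e v w.

(* A cyclic order of T is represented by one of its enumerations [s]; all the
   notions below are invariant under rotation of [s].  The predecessor-successor
   structure of the cyclic order is given by [next s]. *)
Definition cyclic_order (s : seq T) : Prop := uniq s /\ forall v, v \in s.

(* The contiguous intervals of the cyclic order are the [take k (rot i s)];
   [k = 0] is the case of no neighbors. *)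
Definition consecutive_neighbors (s : seq T) (v : T) : Prop :=
  exists i k : nat, forall w, e v w = (w \in take k (rot i s)).

End Graphs.

Section Plane.
Variable R : realType.
Implicit Types (a b c x : R * R) (A K P : set (R * R)).

Definition segment a b : set (R * R) :=
  [set (1 - t) *: a + t *: b | t in [set t : R | 0 <= t <= 1]].

Definition convex_hull A : set (R * R) := smallest (@convex_set R (R * R)%type) A.

Definition corner K x : Prop :=
  K x /\ forall a b (t : R), K a -> K b -> 0 < t < 1 ->
    x = (1 - t) *: a + t *: b -> a = b.

Definition convex_position P : Prop := P `<=` corner (convex_hull P).

(* Twice the signed area of the triangle abc: negative when a, b, c is a
   clockwise turn, i.e. when c lies strictly to the right of the line directed
   from a to b. *)
Definition orientation a b c : R :=
  (b.1 - a.1) * (c.2 - a.2) - (b.2 - a.2) * (c.1 - a.1).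

(* K lies in the closed half-plane to the right of the line directed from a to
   b.  When a and b are distinct corners of the convex polygon K, this says that
   ab is a side of K and that the clockwise traversal of the boundary of K
   goes along it from a to b. *)
Definition clockwise_side K a b : Prop :=
  forall x, K x -> orientation a b x <= 0.

Variable T : finType.

(* Traversing the boundary of the convex hull clockwise from [p v], the first
   vertex met is [p (next s v)]. *)
Definition clockwise_hull_order (s : seq T) (p : T -> R * R) : Prop :=
  forall v, clockwise_side (convex_hull (range p)) (p v) (p (next s v)).

Variables (e : rel T) (p : T -> R * R).

Definition drawing : set (R * R) :=
  range p `|`
  \bigcup_(vw in [set vw : T * T | e vw.1 vw.2]) segment (p vw.1) (p vw.2).

(* The points whose component in the complement of the drawing is unbounded;
   the drawing being compact, there is exactly one unbounded component. *)
Definition outer_face : set (R * R) :=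
  [set x | ~ drawing x /\ ~ bounded_set (connected_component (~` drawing) x)].

Definition outside_obstacle_representation : Prop :=
  [/\ injective p,
      forall u v w, e u v -> segment (p u) (p v) (p w) -> w = u \/ w = v
    & forall v w, nonedge e v w ->
        segment (p v) (p w) `&` outer_face !=set0].

Definition convex_OOR : Prop :=
  outside_obstacle_representation /\ convex_position (range p).

End Plane.

(* Main.v *)
Require Import Defs.
From mathcomp Require Import all_boot all_order all_algebra.
From mathcomp Require Import boolp classical_sets functions.
From mathcomp Require Import reals topology normedtype convex.
From mathcomp Require Import ring lra.

Set Implicit Arguments.
Unset Strict Implicit.
Unset Printing Implicit Defensive.

Import Order.TTheory GRing.Theory Num.Theory.
Import numFieldNormedType.Exports.

Local Open Scope classical_set_scope.
Local Open Scope ring_scope.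

(** Fix a non-edge vw with v in V'.  As the neighbors of v form an interval of
    the cyclic order that avoids v and w, they all lie strictly on one side of
    the line through v and w.  Let d be the direction of the line through the
    two hull neighbors of v: the parallel to it through a point x of the segment
    vw close to v separates v from all other vertices, so it meets no edge that
    is not incident to v.  The half of this parallel that starts at x towards
    the side of vw without neighbors of v meets no edge incident to v either,
    so it is an unbounded connected set avoiding the drawing. *)

(** * Orientation of point triples and convex position *)

Section Cross.
Variable R : realType.
Implicit Types a b c d x y : R * R.

Definition cross a b : R := a.1 * b.2 - a.2 * b.1.

Lemma crossC a b : cross a b = - cross b a.
Proof. by rewrite /cross; ring. Qed.

Lemma crossvv a : cross a a = 0.
Proof. by rewrite /cross; ring. Qed.

Lemma cross0v a : cross 0 a = 0.
Proof. by rewrite /cross /= !mul0r subr0. Qed.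

Lemma crossBr a b c : cross a (b - c) = cross a b - cross a c.
Proof. by rewrite /cross /=; ring. Qed.

Lemma orientationE a b c : orientation a b c = cross (b - a) (c - a).
Proof. by []. Qed.

Lemma orientation_rot a b c : orientation b c a = orientation a b c.
Proof. by rewrite /orientation; ring. Qed.

Lemma cross_plucker a b c d :
  cross a c * cross b d = cross a b * cross c d + cross a d * cross b c.
Proof. by rewrite /cross; ring. Qed.

(** Clockwise turning about [a] is transitive inside the open half-plane to the right of [ab]:
    multiplied by the negative orientation of [a], [b], [y], the claim becomes, by the Plucker
    relation, a sum of two products of negative numbers. *)
Lemma orientation_lt0_trans a b x y c :
  orientation a b x < 0 -> orientation a b y < 0 -> orientation a b c < 0 ->
  orientation a x y < 0 -> orientation a y c < 0 -> orientation a x c < 0.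
Proof.
rewrite !orientationE => bx by_ bc xy yc.
rewrite -(nmulr_rgt0 _ by_) cross_plucker.
by rewrite addr_gt0 // nmulr_rgt0.
Qed.

Lemma sqrnorm_gt0 a : a != 0 -> 0 < a.1 ^+ 2 + a.2 ^+ 2.
Proof.
move=> a0; rewrite lt_def addr_ge0 ?sqr_ge0 // andbT.
apply: contra a0; rewrite paddr_eq0 ?sqr_ge0 // !sqrf_eq0.
by case: a => a1 a2 /= /andP[/eqP-> /eqP->].
Qed.

Lemma orientation_eq0_line a b c :
  a != b -> orientation a b c = 0 -> exists t, c = (1 - t) *: a + t *: b.
Proof.
move=> ab abc; have /sqrnorm_gt0 /= n0 : b - a != 0 by rewrite subr_eq0 eq_sym.
pose dot := (b.1 - a.1) * (c.1 - a.1) + (b.2 - a.2) * (c.2 - a.2).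
(* The parameter of the orthogonal projection of [c] onto the line [ab]; the projection error is a
   multiple of [orientation a b c]. *)
exists (dot / ((b.1 - a.1) ^+ 2 + (b.2 - a.2) ^+ 2)).
have line (x y z : R) : dot * (y - x) = (z - x) * ((b.1 - a.1) ^+ 2 + (b.2 - a.2) ^+ 2) ->
    z = (1 - dot / ((b.1 - a.1) ^+ 2 + (b.2 - a.2) ^+ 2)) * x +
        dot / ((b.1 - a.1) ^+ 2 + (b.2 - a.2) ^+ 2) * y.
  move: (_ ^+ 2 + _) n0 => n n0 E.
  have -> : z = x + (z - x) * n / n by rewrite mulfK ?gt_eqF // addrC subrK.
  by rewrite -E; ring.
rewrite [LHS]surjective_pairing; congr pair; apply: line.
- have -> : dot * (b.1 - a.1) = (c.1 - a.1) *
      ((b.1 - a.1) ^+ 2 + (b.2 - a.2) ^+ 2) + (b.2 - a.2) * orientation a b c.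
    by rewrite /dot /orientation; ring.
  by rewrite abc mulr0 addr0.
- have -> : dot * (b.2 - a.2) = (c.2 - a.2) *
      ((b.1 - a.1) ^+ 2 + (b.2 - a.2) ^+ 2) - (b.1 - a.1) * orientation a b c.
    by rewrite /dot /orientation; ring.
  by rewrite abc mulr0 subr0.
Qed.

Lemma corner_between K x a b t :
  corner K x -> K a -> K b -> x != a -> x != b -> 0 <= t <= 1 ->
  x <> (1 - t) *: a + t *: b.
Proof.
move=> [_ cx] Ka Kb xa xb /andP[t0 t1] xE.
have [t_0|t_neq0] := eqVneq t 0.
  by move: xa; rewrite xE t_0 subr0 scale1r scale0r addr0 eqxx.
have [t_1|t_neq1] := eqVneq t 1.
  by move: xb; rewrite xE t_1 subrr scale1r scale0r add0r eqxx.
have t01 : 0 < t < 1 by rewrite !lt_neqAle eq_sym t_neq0 t0 t_neq1 t1.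
have ab := cx _ _ _ Ka Kb t01 xE.
by move: xa; rewrite xE -ab -scalerDl subrK scale1r eqxx.
Qed.

Lemma sub_convex_hull (A : set (R * R)) : A `<=` convex_hull A.
Proof. exact: sub_gen_smallest. Qed.

(** Of three collinear points one lies between the other two, which a corner cannot do. It is [a],
    [c] or [b] according to the position of [t] relative to 0 and 1; solving for that point gives
    the new parameter. *)
Lemma convex_position_orientation_neq0 P a b c : convex_position P ->
  P a -> P b -> P c -> a != b -> b != c -> a != c -> orientation a b c != 0.
Proof.
move=> Pc Pa Pb Pc' ab bc ac; apply/eqP => /(orientation_eq0_line ab)[t cE].
have hull := @sub_convex_hull P.
have [t0|t0] := ltP t 0.
  apply: (corner_between (t := - t / (1 - t)) (Pc _ Pa)
    (hull _ Pc') (hull _ Pb)) => //.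
    by rewrite ler_pdivrMr ?divr_ge0; lra.
  rewrite cE; case: (a) (b) => [a1 a2] [b1 b2].
  by congr pair; rewrite /= /GRing.scale /=; field; rewrite gt_eqF //; lra.
have [t1|t1] := leP t 1.
  apply: (corner_between (t := t) (Pc _ Pc') (hull _ Pa) (hull _ Pb)) => //.
  - by rewrite eq_sym.
  - by rewrite eq_sym.
  - by rewrite t0.
apply: (corner_between (t := 1 / t) (Pc _ Pb) (hull _ Pa) (hull _ Pc')) => //.
- by rewrite eq_sym.
- by rewrite ler_pdivrMr ?divr_ge0; lra.
rewrite cE; case: (a) (b) => [a1 a2] [b1 b2].
by congr pair; rewrite /= /GRing.scale /=; field; rewrite gt_eqF //; lra.
Qed.

End Cross.

(** * Half-lines in a normed space *)

Section Ray.
Variables (R : realType) (V : normedModType R).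
Implicit Types x d : V.

Definition ray x d : set V := [set x + t *: d | t in [set t | 0 <= t]].

Lemma ray_origin x d : ray x d x.
Proof. by exists 0 => /=; rewrite ?scale0r ?addr0. Qed.

Lemma ray_connected x d : connected (ray x d).
Proof.
apply: connected_continuous_connected.
  by apply/connected_intervalP => a b /= a0 _ c /andP[ac _]; exact: le_trans ac.
apply: continuous_subspaceT => t.
by apply: cvgD; [exact: cvg_cst|apply: cvgZr_tmp; exact: cvg_id].
Qed.

Lemma ray_unbounded x d : d != 0 -> ~ bounded_set (ray x d).
Proof.
move=> d0 [M [_ MP]]; have dgt0 : 0 < `|d| by rewrite normr_gt0.
pose N := `|M| + 1; have MN : M < N by rewrite ltr_pwDr // ler_norm.
have N0 : 0 <= N by rewrite addr_ge0.
(* Large enough that, after subtracting the norm of [x], the norm is still at least [N + 1]. *)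
pose t := (N + `|x| + 1) / `|d|.
have t0 : 0 <= t by rewrite divr_ge0 // !addr_ge0.
have xtd : ray x d (x + t *: d) by exists t.
have /= := MP N MN _ xtd; apply/negP; rewrite -ltNge.
have : `|t *: d| <= `|x + t *: d| + `|x|.
  by rewrite -[X in `|X| <= _](addKr x) addrC (le_trans (ler_normB _ _)).
rewrite normrZ (ger0_norm t0) /t divfK ?gt_eqF //; lra.
Qed.

End Ray.

(** * Escape from a non-edge to infinity *)

Section Escape.
Variables (R : realType) (T : finType) (e : rel T) (p : T -> R * R).

(** The component of [x] contains the connected set [ray x d] and inherits its unboundedness. *)
Lemma ray_outer_face x d : d != 0 -> ray x d `<=` ~` drawing e p ->
  outer_face e p x.
Proof.
move=> d0 rayD; split; first exact: rayD (ray_origin x d).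
have sub := connected_component_max (ray_origin x d) rayD (@ray_connected _ _ x d).
move=> [M [Mr MP]]; apply: (@ray_unbounded _ _ x d) => //.
by exists M; split=> // N /MP NP y /sub; exact: NP.
Qed.

(* The sign of [c] selects the half-line: the ray goes in direction [c *: d]. *)
Lemma nonedge_escape v w d c : symmetric e -> w != v -> c != 0 ->
  (forall u, u != v -> 0 < cross (p u - p v) d) ->
  (forall u, e v u -> c * orientation (p v) (p w) (p u) < 0) ->
  segment (p v) (p w) `&` outer_face e p !=set0.
Proof.
move=> e_sym wv c0 dpos side.
(* Up to scaling, the distance of [p u] from the parallel to [d] through [p v]. *)
pose f u := cross (p u - p v) d.
have [u0 u0v fmin] := @arg_minP _ _ _ w (fun u => u != v) f wv.
have fw : 0 < f w := dpos _ wv; have m0 : 0 < f u0 := dpos _ u0v.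
(* Puts [x] at half the lowest level of a vertex other than [v]; the ray, parallel to [d], stays at
   this level. *)
pose eps := f u0 / (2 * f w).
have eps0 : 0 < eps by rewrite divr_gt0 ?mulr_gt0.
have epsw : eps * f w = f u0 / 2 by rewrite /eps; field; rewrite gt_eqF.
have eps1 : eps <= 1.
  by rewrite ler_pdivrMr ?mulr_gt0 // mul1r; have := fmin _ wv; lra.
pose x := (1 - eps) *: p v + eps *: p w.
exists x; split; first by exists eps => //=; rewrite (ltW eps0).
apply: (@ray_outer_face _ (c *: d)).
  rewrite scaler_eq0 negb_or c0; apply/eqP => d0; move: fw.
  by rewrite /f d0 /cross /= !mulr0 subrr ltxx.
move=> _ [t /= t0 <-].
set y := x + _.
have y_d : cross (y - p v) d = f u0 / 2.
  rewrite -epsw /f /y /x /cross /= /GRing.scale /=; ring.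
have y_w : c * cross (p w - p v) (y - p v) = t * c ^+ 2 * f w.
  rewrite /f /y /x /cross /= /GRing.scale /=; ring.
have vtx u : y = p u -> False.
  move=> yu; move: y_d; rewrite yu; have [->|uv] := eqVneq u v.
    by rewrite subrr cross0v; lra.
  by rewrite -/(f u); have := fmin _ uv; lra.
(* A point of the edge other than [p v] lies strictly on the neighbors' side of [vw], which the ray
   never enters. *)
have inc u : e v u -> segment (p v) (p u) y -> False.
  move=> /side cu [tau /andP[tau0 tau1] yE].
  have : t * c ^+ 2 * f w = tau * (c * orientation (p v) (p w) (p u)).
    rewrite -y_w -yE orientationE /cross /= /GRing.scale /=; ring.
  have : 0 <= t * c ^+ 2 * f w by rewrite mulr_ge0 ?(ltW fw) // mulr_ge0 ?sqr_ge0.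
  have [tau_0 _ _|tau_neq0] := eqVneq tau 0.
    by apply: (vtx v); rewrite -yE tau_0 subr0 scale1r scale0r addr0.
  move=> + E; rewrite E leNgt => /negP; apply.
  by rewrite pmulr_rlt0 // lt_def tau_neq0.
case=> [[u _ /esym /vtx] //|[[a b] /= eab ab]].
have [av|av] := eqVneq a v; first by rewrite av in eab ab; exact: inc eab ab.
have [bv|bv] := eqVneq b v.
  rewrite bv e_sym in eab; apply: (inc _ eab); rewrite -bv.
  case: ab => tau /= /andP[tau0 tau1] <-.
  by exists (1 - tau) => /=; [apply/andP; split; lra|rewrite subKr addrC].
(* Both ends of the edge, hence all its points, are at level at least [f u0]. *)
case: ab => tau /= /andP[tau0 tau1] yE.
have : (1 - tau) * f a + tau * f b = f u0 / 2.
  rewrite -y_d -yE /f /cross /= /GRing.scale /=; ring.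
have := fmin _ av; have := fmin _ bv.
nra.
Qed.

End Escape.

(** * The clockwise order around a vertex *)

Section ClockwiseOrder.
Variables (R : realType) (T : finType) (p : T -> R * R).
Hypothesis p_inj : injective p.
Hypothesis p_convex : convex_position (range p).

Lemma orientation_neq0 a b c :
  a != b -> b != c -> a != c -> orientation (p a) (p b) (p c) != 0.
Proof.
by move=> ab bc ac; apply: (convex_position_orientation_neq0 p_convex);
  rewrite ?(inj_eq p_inj) //; exists a + exists b + exists c.
Qed.

(** Each hull side has [p v] on its right, which settles consecutive vertices of [s]; transitivity
    extends this to all pairs. *)
Lemma clockwise_pairwise v s : uniq (v :: s) -> clockwise_hull_order (v :: s) p ->
  pairwise (fun x y => orientation (p v) (p x) (p y) < 0) s.
Proof.
move=> Us ord.
pose r x y := [forall z, orientation (p x) (p y) (p z) <= 0].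
have /(cycle_from_next Us) : forall x, x \in v :: s -> r x (next (v :: s) x).
  by move=> x _; apply/forallP => z; apply: ord; apply: sub_convex_hull; exists z.
case: s Us {ord} => // b s /=; rewrite !inE !negb_or -!andbA.
case/and4P => vb vs bs us /andP[rvb].
have neg x y : x != y -> v != x -> v != y -> r x y ->
    orientation (p v) (p x) (p y) < 0.
  move=> xy vx vy /forallP/(_ v).
  by rewrite orientation_rot lt_neqAle orientation_neq0.
have first z : z \in s -> orientation (p v) (p b) (p z) < 0.
  move=> zs; have vz : v != z by apply: contraNneq vs => ->.
  have bz : b != z by apply: contraNneq bs => ->.
  by rewrite lt_neqAle orientation_neq0 //=; move/forallP: rvb.
rewrite rcons_path => /andP[rs _].
have all_first : all (fun z => orientation (p v) (p b) (p z) < 0) s.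
  by apply/allP => z /first.
(* Transitivity is available only to the right of the first side, from [p v] to [p b], where all of
   [s] lies. *)
rewrite all_first /= -(sorted_pairwise_in _ all_first); last first.
  by move=> y x z by_ bx bz; exact: (orientation_lt0_trans bx by_ bz).
move: rs => /path_sorted.
elim: s us vs {bs first all_first} => // x [//|y s] IH.
case/andP=> xys uys; rewrite inE negb_or => /andP[vx vys] /= /andP[rxy rs].
apply/andP; split; last exact: IH uys vys rs.
rewrite neg //; last by apply: contraNneq vys => ->; rewrite mem_head.
by apply: contraNneq xys => ->; rewrite mem_head.
Qed.

(** With [b] first and [a] last in [s], the direction [p b - p a] works: the cross product is minus
    the sum of the orientations of [v], [b], [u] and of [v], [u], [a], neither positive and not both
    zero. *)
Lemma separating_direction v s : (forall u, u \in v :: s) ->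
  pairwise (fun x y => orientation (p v) (p x) (p y) < 0) s ->
  exists d, forall u, u != v -> 0 < cross (p u - p v) d.
Proof.
case: s => [|b s] memT.
  by exists 0 => u; have := memT u; rewrite inE => /eqP->; rewrite eqxx.
case: (lastP s) memT => [|{}s a] memT.
  (* With two vertices only, both hull neighbors of [v] coincide. *)
  pose q := p b - p v; exists (- q.2, q.1) => u uv.
  have := memT u; rewrite !inE (negPf uv) /= => /eqP ub; rewrite ub in uv *.
  have /sqrnorm_gt0 : q != 0 by rewrite subr_eq0 (inj_eq p_inj).
  by rewrite /cross /= mulrN opprK !expr2.
rewrite /= all_rcons -cats1 pairwise_cat /= allrel1r => /andP[/andP[ba bs]].
case/andP=> sa _.
exists (p b - p a) => u uv.
have -> : p b - p a = (p b - p v) - (p a - p v) by rewrite opprB addrA subrK.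
rewrite crossBr [X in X - _]crossC -!orientationE.
have := memT u; rewrite !inE (negPf uv) mem_rcons inE /= => /or3P[/eqP->|/eqP->|us].
- by rewrite [X in - X]orientationE crossvv oppr0 sub0r oppr_gt0.
- by rewrite [X in _ - X]orientationE crossvv subr0 oppr_gt0.
- by move/allP/(_ _ us): sa; move/allP/(_ _ us): bs; lra.
Qed.

End ClockwiseOrder.

(** The prefix [take k s] avoids [v] and [w], so it lies within one of the two arcs between them and
    misses the other. *)
Lemma rot_split_arc (T : eqType) (s : seq T) k v w :
  uniq s -> v \in s -> w \in s -> v != w ->
  v \notin take k s -> w \notin take k s ->
  exists i s1 s2, rot i s = v :: s1 ++ w :: s2 /\
    ({in s1, forall u, u \notin take k s} \/ {in s2, forall u, u \notin take k s}).
Proof.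
move: (cat_take_drop k s); move: (take k s) (drop k s) => A B <-.
rewrite cat_uniq !mem_cat => /and3P[_ /hasPn AB _] + + vw vA wA.
rewrite (negPf vA) (negPf wA) /= => vB.
case/splitPr: vB AB => B1 B2 AB; rewrite mem_cat inE eq_sym (negPf vw) /=.
case/orP => [wB1|wB2].
- case/splitPr: wB1 AB => B1' B3 AB.
  exists (size (A ++ B1' ++ w :: B3)), (B2 ++ A ++ B1'), B3; split.
    by rewrite [X in rot _ X]catA rot_size_cat /= -!catA.
  by right=> u uB3; apply: AB; rewrite !(mem_cat, inE) uB3 !orbT.
- case/splitPr: wB2 AB => B2' B3 AB.
  exists (size (A ++ B1)), B2', (B3 ++ A ++ B1); split.
    by rewrite [X in rot _ X]catA rot_size_cat /= -!catA.
  by left=> u uB2; apply: AB; rewrite !(mem_cat, inE) uB2 !orbT.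
Qed.

(** * From intervals of neighbors to the outside-obstacle representation *)

Theorem lemma3 (R : realType) (T : finType) (e : rel T)
    (e_sym : symmetric e) (e_irr : irreflexive e)
    (s : seq T) (s_cyc : cyclic_order s)
    (V' : {set T})
    (V'_cover : forall v w : T, nonedge e v w -> (v \in V') || (w \in V'))
    (V'_consec : forall v : T, v \in V' -> consecutive_neighbors e s v)
    (P : set (R * R)) (P_convex : convex_position P)
    (p : T -> R * R) (p_bij : set_bij setT P p)
    (p_order : clockwise_hull_order s p) :
  convex_OOR e p.
Proof.
have [Us memT] := s_cyc.
have [pP pI pS] := p_bij.
have p_inj : injective p by move=> a b; apply: pI; rewrite in_setT.
have rP : range p = P.
  by apply/seteqP; split=> [_ [a _ <-]|]; [exact: pP|exact: pS].
have p_convex : convex_position (range p) by rewrite rP.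
have hull a : convex_hull (range p) (p a) by apply: sub_convex_hull; exists a.
have pneq a b : a != b -> p a != p b by rewrite (inj_eq p_inj).
split=> //; split=> // [u v w euv [t /= t01 wE]|v w].
  have [->|wu] := eqVneq w u; first by left.
  have [->|wv] := eqVneq w v; first by right.
  have pw : range p (p w) by exists w.
  by case: (corner_between (p_convex _ pw) (hull u) (hull v) _ _ t01 (esym wE));
    exact: pneq.
wlog vV : v w / v \in V' => [hyp|] vw.
  have [|wV] := orP (V'_cover _ _ vw); first by move=> vV; exact: hyp.
  have [|x [[t /= /andP[t0 t1] tE] xO]] := hyp w v wV.
    by rewrite /nonedge eq_sym e_sym.
  exists x; split=> //; exists (1 - t); first by apply/andP; split; lra.
  by rewrite subKr addrC.
have [i [k nbr]] := V'_consec v vV.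
have /andP[v_neq_w evw] := vw.
(* In [rot i s] the neighbors of [v] form a prefix. *)
have [||||||j [s1 [s2 [sE dis]]]] := rot_split_arc (s := rot i s) (k := k) (v := v) (w := w).
- by rewrite rot_uniq.
- by rewrite mem_rot.
- by rewrite mem_rot.
- by [].
- by rewrite -nbr e_irr.
- by rewrite -nbr.
have Ut : uniq (v :: s1 ++ w :: s2) by rewrite -sE !rot_uniq.
have memt u : u \in v :: s1 ++ w :: s2 by rewrite -sE !mem_rot.
have ordt : clockwise_hull_order (v :: s1 ++ w :: s2) p.
  by move=> u; rewrite -sE !next_rot ?rot_uniq.
have cw := clockwise_pairwise p_inj p_convex Ut ordt.
have [d dpos] := separating_direction p_inj memt cw.
(* Seen from [v] towards [w], [s1] lies strictly to the left and [s2] strictly to the right. *)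
move: cw; rewrite pairwise_cat allrel_consr /= => /and3P[/andP[cw1 _] _ /andP[cw2 _]].
have split_nbr u : e v u -> (u \in s1) || (u \in s2).
  move=> evu; have := memt u; rewrite !inE mem_cat inE.
  have [uv|_] := eqVneq u v; first by rewrite uv e_irr in evu.
  by have [uw|_] := eqVneq u w; first by rewrite uw (negPf evw) in evu.
(* The neighbors all lie in the other arc; [c = 1] sends the ray to the left of [vw] and [c = -1] to
   the right, away from them. *)
case: dis => dis.
- apply: (nonedge_escape (c := 1)) e_sym _ _ dpos _.
  + by rewrite eq_sym.
  + exact: oner_neq0.
  move=> u evu; rewrite mul1r.
  have us : u \in s2.
    by case/orP: (split_nbr _ evu) => // /dis; rewrite -nbr evu.
  by move/allP: cw2; apply.
- apply: (nonedge_escape (c := -1)) e_sym _ _ dpos _.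
  + by rewrite eq_sym.
  + by rewrite oppr_eq0 oner_neq0.
  move=> u evu; rewrite mulN1r orientationE -crossC -orientationE.
  have us : u \in s1.
    by case/orP: (split_nbr _ evu) => // /dis; rewrite -nbr evu.
  by move/allP: cw1; apply.
Qed.
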